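(* Let $s\ge1$, $m\ge0$, $k\ge0$ be integers. Then $\sum_{\pi\in\mathrm{PF}(m,m+s-1)}\binom{\mathrm{disp}(\pi)}{k}$ equals the number of (simple) graphs with $m+k$ edges on $m+s$ labeled vertices which have exactly $s$ connected components, each containing exactly one of $s$ specified vertices.
   Context: For $0\le m\le n$, $\mathrm{PF}(m,n)$ is the set of sequences $\pi=(\pi_1,\dots,\pi_m)\in\{1,\dots,n\}^m$ such that, when spots $1,\dots,n$ are initially empty and for $i=1,\dots,m$ in turn car $i$ parks in the first empty spot among $\pi_i,\pi_i+1,\dots,n$, every car parks; if car $i$ parks in spot $\mathcal O(\pi)_i$, the displacement is $\mathrm{disp}(\pi)=\sum_i(\mathcal O(\pi)_i-\pi_i)$. *)

(* Defs.v *)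
From mathcomp Require Import all_boot.

Set Implicit Arguments.
Unset Strict Implicit.
Unset Printing Implicit Defensive.

(* The spots 1, ..., n are represented by 'I_n = {0, ..., n - 1}.             *)
Section Parking.

Variable n : nat.
Implicit Types (x : 'I_n) (p : seq 'I_n) (occ : {set 'I_n}).

(* [enum 'I_n] is increasing, so the head is the least admissible spot.       *)
Definition first_empty occ x : option 'I_n :=
  ohead [seq y : 'I_n <- enum 'I_n | (x <= y) && (y \notin occ)].

(* [occ] is the set of occupied spots; [None] when some car fails to park.    *)
Fixpoint park occ p : option (seq 'I_n) :=
  if p is x :: p' then
    if first_empty occ x is Some y then omap (cons y) (park (y |: occ) p')
    else None
  else Some [::].

Definition outcome p : option (seq 'I_n) := park set0 p.

(* Each car parks at or after its preferred spot, so no subtraction truncates.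
   The value 0 outside PF is junk.                                            *)
Definition disp p : nat :=
  if outcome p is Some o then \sum_(yx <- zip o p) (yx.1 - yx.2) else 0.

End Parking.

Definition PF (m n : nat) : {set m.-tuple 'I_n} :=
  [set p : m.-tuple 'I_n | isSome (outcome p)].

(* A graph on V is given by its edge set, a set of two-element subsets of V.  *)
Section Graphs.

Variable V : finType.
Implicit Types (E : {set {set V}}) (S : {set V}).

Definition simple_graph E : bool := [forall e in E, #|e| == 2].

Definition adj E : rel V := [rel x y | [set x; y] \in E].

Definition components E : {set {set V}} :=
  [set [set y | connect (adj E) x y] | x : V].

Definition rooted_graphs S (e s : nat) : {set {set {set V}}} :=
  [set E | [&& simple_graph E, #|E| == e, #|components E| == s
             & [forall C in components E, #|C :&: S| == 1]]].

End Graphs.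

(* Main.v *)
(* Run through the spots from left to right, keeping the queue of cars that have
   passed their preference and still look for a spot. The queue lengths depend
   only on how many cars prefer each spot; they sum to the displacement, and all
   cars park iff the final queue is empty.

   A graph as in the theorem is explored one vertex at a time, keeping the queue
   of vertices that are discovered but not yet processed. Processing a vertex
   reveals a set of c new vertices (c cars prefer the next spot) and an arbitrary
   set of edges to the vertices in the queue. These optional edges contribute
   (1 + X) ^ (queue length), so the generating polynomial of the graphs by number
   of edges is the sum over parking functions of X ^ m (1 + X) ^ disp. When the
   queue is empty, the next root is taken from the unused ones; this is an empty
   spot. *)
Require Import Defs.
From mathcomp Require Import all_boot all_algebra zify ring.

Set Implicit Arguments.
Unset Strict Implicit.
Unset Printing Implicit Defensive.

Import GRing.Theory Num.Theory.

(** * Queue lengths of a parking process *)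

(* [cs] lists the number of cars preferring each successive spot, and [w] cars
   are waiting in front of the first of these spots; one car leaves the queue at
   each spot, unless it is empty. *)
Fixpoint waiting w (cs : seq nat) : nat :=
  if cs is c :: cs' then waiting (w + c).-1 cs' else w.

(** Each car still in the queue after a spot moves on by one spot, so the queue lengths add up to
    the displacement. *)
Fixpoint delay w (cs : seq nat) : nat :=
  if cs is c :: cs' then (w + c).-1 + delay (w + c).-1 cs' else 0.

(** A spot is taken iff some car is available there. Below, [nth true] makes positions past the last
    spot count as taken. *)
Fixpoint busy w (cs : seq nat) : seq bool :=
  if cs is c :: cs' then (0 < w + c) :: busy (w + c).-1 cs' else [::].

Lemma size_busy w cs : size (busy w cs) = size cs.
Proof. by elim: cs w => //= c cs IH w; rewrite IH. Qed.

Lemma busy_nseq0 n : busy 0 (nseq n 0) = nseq n false.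
Proof. by elim: n => //= n ->. Qed.

Lemma waiting_nseq0 n : waiting 0 (nseq n 0) = 0.
Proof. by elim: n. Qed.

Lemma delay_nseq0 n : delay 0 (nseq n 0) = 0.
Proof. by elim: n. Qed.

Lemma leq_waiting w w' cs : w <= w' -> waiting w cs <= waiting w' cs.
Proof. by elim: cs w w' => //= c cs IH w w' le_w; apply: IH; lia. Qed.

Lemma leq_waiting_incr w cs x : x < size cs ->
  waiting w cs <= waiting w (incr_nth cs x).
Proof.
elim: cs w x => //= c cs IH w [|x] lt_x /=; last exact: IH.
by apply: leq_waiting; lia.
Qed.

Lemma leq_waiting_foldl n w cs (p : seq 'I_n) : size cs = n ->
  waiting w cs <= waiting w (foldl (fun cs x => incr_nth cs (val x)) cs p).
Proof.
elim: p cs => //= x p IH cs size_cs.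
have lt_x : x < size cs by rewrite size_cs.
apply: leq_trans (leq_waiting_incr w lt_x) (IH _ _).
by rewrite size_incr_nth lt_x.
Qed.

(** The extra car lengthens the queue by one after each of the spots before [y] and is absorbed by
    [y], the first free spot. *)
Lemma waitingS w cs y : y < size cs -> ~~ nth true (busy w cs) y ->
    (forall z, z < y -> nth true (busy w cs) z) ->
  [/\ waiting w.+1 cs = waiting w cs, delay w.+1 cs = delay w cs + y
    & forall z, nth true (busy w.+1 cs) z = (z == y) || nth true (busy w cs) z].
Proof.
elim: cs w y => //= c cs IH w [|y] lt_y free_y before_y.
  have -> : w = 0 by move: free_y => /=; lia.
  have -> : c = 0 by move: free_y => /=; lia.
  by split=> [||[]] //=; rewrite !addn0.
have := before_y 0 isT; move: free_y before_y; rewrite /= addSn.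
case: (w + c) => [|v] //= free_y before_y _.
have [z lt_z|-> -> busyE] := IH v y lt_y free_y; first exact: (before_y z.+1).
by split=> [||[|z]] //=; lia.
Qed.

(** Nothing changes before [x]; from there on the new car acts as one more waiting car, to which
    [waitingS] applies. *)
Lemma waiting_incr w cs x y : x <= y < size cs -> ~~ nth true (busy w cs) y ->
    (forall z, x <= z < y -> nth true (busy w cs) z) ->
  [/\ waiting w (incr_nth cs x) = waiting w cs,
      delay w (incr_nth cs x) = delay w cs + (y - x)
    & forall z, nth true (busy w (incr_nth cs x)) z
                = (z == y) || nth true (busy w cs) z].
Proof.
elim: cs w x y => [|c cs IH] w [|x] [|y] //= le_xy free_y busy_xy.
- have -> : w = 0 by lia.
  have -> : c = 0 by lia.
  by split=> [||[]] //=; rewrite !addn0.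
- have := busy_xy 0 isT; move: free_y busy_xy; rewrite addnS.
  case: (w + c) => [|v] //= free_y busy_xy _.
  have [z lt_z|-> -> busyE] := @waitingS v cs y le_xy free_y.
    exact: (busy_xy z.+1).
  by split=> [||[|z]] //=; lia.
- have [z lt_z|-> -> busyE] := IH (w + c).-1 x y le_xy free_y.
    exact: (busy_xy z.+1).
  by split=> [||[|z]] //=; lia.
Qed.

Lemma waitingS_busy w cs : (forall z, nth true (busy w cs) z) ->
  waiting w.+1 cs = (waiting w cs).+1.
Proof.
elim: cs w => //= c cs IH w busy_w.
move: (busy_w 0) (fun z => busy_w z.+1) => /=.
by case: (w + c) => //= v _ /IH.
Qed.

Lemma waiting_incr_busy w cs x : x < size cs ->
    (forall z, x <= z -> nth true (busy w cs) z) ->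
  waiting w (incr_nth cs x) = (waiting w cs).+1.
Proof.
elim: cs w x => //= c cs IH w [|x] lt_x busy_x.
  rewrite /= addnS; move: (busy_x 0 isT) (fun z => busy_x z.+1 isT) => /=.
  by case: (w + c) => //= v _ /waitingS_busy.
by apply: IH => // z; apply: (busy_x z.+1).
Qed.

Lemma first_emptyP n (occ : {set 'I_n}) (x : 'I_n) :
  match first_empty occ x with
  | Some y => [/\ x <= y, y \notin occ & forall z : 'I_n, x <= z < y -> z \in occ]
  | None => forall z : 'I_n, x <= z -> z \in occ
  end.
Proof.
rewrite /first_empty.
set s := [seq y <- enum 'I_n | _].
have s_sorted : sorted (fun y z : 'I_n => y < z) s.
  apply: sorted_filter => [a b c|]; first exact: ltn_trans.
  have : sorted ltn (map val (enum 'I_n)) by rewrite val_enum_ord iota_ltn_sorted.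
  by rewrite sorted_map.
have mem_sE z : (z \in s) = (x <= z) && (z \notin occ).
  by rewrite mem_filter mem_enum andbT.
case: s s_sorted mem_sE => [|y s] /= y_path mem_sE.
  by move=> z le_xz; apply: contraT => free_z; move: (mem_sE z); rewrite le_xz free_z.
have /andP[le_xy free_y] : (x <= y) && (y \notin occ).
  by rewrite -mem_sE mem_head.
split=> // z /andP[le_xz lt_zy]; apply: contraLR lt_zy => free_z.
have := mem_sE z; rewrite le_xz free_z inE => /predU1P[-> | z_s].
  by rewrite ltnn.
have lt_trans : transitive (fun y z : 'I_n => y < z).
  by move=> a b c; apply: ltn_trans.
have /allP/(_ z z_s) := order_path_min lt_trans y_path.
by rewrite -leqNgt => /ltnW.
Qed.

(** Invariant for induction on the remaining cars: [cs] counts the preferences of the cars already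
    parked, and [occ] is the set of spots they occupy. *)
Lemma parkE n (cs : seq nat) (occ : {set 'I_n}) p : size cs = n ->
    (forall y : 'I_n, (y \in occ) = nth true (busy 0 cs) y) ->
    waiting 0 cs = 0 ->
  let cs' := foldl (fun cs x => incr_nth cs (val x)) cs p in
  if park occ p is Some o then
    waiting 0 cs' = 0 /\ delay 0 cs' = delay 0 cs + \sum_(yx <- zip o p) (yx.1 - yx.2)
  else waiting 0 cs' != 0.
Proof.
elim: p cs occ => /= [|x p IH] cs occ size_cs occE wait0.
  by rewrite big_nil addn0.
have lt_x : x < size cs by rewrite size_cs.
have size_cs' : size (incr_nth cs x) = n by rewrite size_incr_nth lt_x.
move: (first_emptyP occ x); case: first_empty => [y [le_xy free_y busy_xy]|busy_x].
  have [|||waitE delayE busyE] := @waiting_incr 0 cs x y.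
  - by rewrite le_xy size_cs /=.
  - by rewrite -occE.
  - move=> z /andP[le_xz lt_zy].
    have lt_z : z < n by apply: ltn_trans lt_zy _.
    by rewrite -(occE (Ordinal lt_z)) busy_xy //= le_xz.
  have {}IH := IH (incr_nth cs x) (y |: occ) size_cs' _ _.
  move: IH; case: park => [o|] /= IH; last first.
    by apply: IH; rewrite ?waitE // => z; rewrite busyE !inE occE.
  have [|| -> ->] := IH; rewrite ?waitE //.
    by move=> z; rewrite busyE !inE occE.
  by rewrite delayE big_cons addnA.
(* The car finds no spot, so it stays in the final queue, which later cars cannot shorten. *)
rewrite -lt0n; apply: leq_trans (leq_waiting_foldl _ _ size_cs').
rewrite waiting_incr_busy // => z le_xz.
have [lt_z | le_nz] := ltnP z n; last by rewrite nth_default // size_busy size_cs.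
by rewrite -(occE (Ordinal lt_z)) busy_x.
Qed.

(** * Sums over preference lists *)

Section SumCounts.

Variable M : nmodType.
Local Open Scope ring_scope.

(* Sum of [F] over the preference lists of [u] labelled cars on [n] spots, when
   [F] depends only on the number of cars preferring each spot. *)
Fixpoint sum_counts (n u : nat) (F : seq nat -> M) : M :=
  if n is n'.+1 then
    \sum_(c < u.+1) sum_counts n' (u - c)%N (fun cs => F (val c :: cs)) *+ 'C(u, c)
  else if u == 0%N then F [::] else 0.

Lemma eq_sum_counts n u F G : F =1 G -> sum_counts n u F = sum_counts n u G.
Proof.
elim: n u F G => /= [|n IH] u F G eqFG; first by rewrite eqFG.
by apply: eq_bigr => c _; congr (_ *+ _); apply: IH => cs; apply: eqFG.
Qed.

Lemma sum_counts0 n F : sum_counts n 0 F = F (nseq n 0%N).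
Proof. by elim: n F => //= n IH F; rewrite big_ord1 /= IH. Qed.

(* Pascal's rule: single out the preference of one of the cars. *)
Lemma sum_counts_incr n u F :
  sum_counts n u.+1 F
  = \sum_(x < n) sum_counts n u (fun cs => F (incr_nth cs x)).
Proof.
elim: n u F => [|n IH] u F; first by rewrite big_ord0.
pose G c := sum_counts n (u.+1 - c)%N (fun cs => F (c :: cs)).
have -> : sum_counts n.+1 u.+1 F = \sum_(c < u.+2) G c *+ 'C(u.+1, c) by [].
rewrite [RHS]big_ord_recl big_ord_recl /= bin0.
under eq_bigr => c _ do rewrite binS mulrnDr addrC.
rewrite big_split /= addrCA; congr (_ + _).
(* The remaining terms are those where the chosen car prefers a later spot, so [c] counts only cars
   among the other [u]. *)
have -> : G 0%N *+ 1 + \sum_(c < u.+1) G c.+1 *+ 'C(u, c.+1)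
          = \sum_(c < u.+1) G c *+ 'C(u, c).
  rewrite big_ord_recr /= bin_small // mulr0n addr0.
  by rewrite [RHS]big_ord_recl bin0.
rewrite exchange_big; apply: eq_bigr => c _ /=.
by rewrite /G subSn ?IH -?sumrMnl // -ltnS.
Qed.

Lemma sum_tuple_counts n m F :
  \sum_(p : m.-tuple 'I_n)
     F (foldl (fun cs x => incr_nth cs (val x)) (nseq n 0%N) p)
  = sum_counts n m F.
Proof.
elim: m F => [|m IH] F.
  rewrite sum_counts0 (bigD1 [tuple]) //= big1 ?addr0 // => p.
  by case/eqP; apply: tuple0.
rewrite sum_counts_incr.
under [RHS]eq_bigr => x _ do rewrite -IH.
rewrite pair_bigA /=.
rewrite (reindex (fun xp : 'I_n * m.-tuple 'I_n => [tuple of xp.1 :: xp.2])) /=.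
  apply: eq_bigr => -[x p] _ /=; congr F.
  elim: (val p) (nseq n 0%N) => //= y s IHs cs.
  by rewrite incr_nthC IHs.
exists (fun p => (thead p, [tuple of behead p])) => [[x p] _|p _] /=.
  by rewrite theadE; congr (_, _); apply: val_inj.
by rewrite -tuple_eta.
Qed.

End SumCounts.

Local Open Scope ring_scope.

Lemma sum_countsZ (R : comNzRingType) n u (a : R) F :
  sum_counts n u (fun cs => a * F cs) = a * sum_counts n u F.
Proof.
elim: n u F => /= [|n IH] u F; first by case: eqP; rewrite ?mulr0.
by rewrite mulr_sumr; apply: eq_bigr => c _; rewrite IH mulrnAr.
Qed.

(** * Generating polynomial of preference lists by displacement *)

Section QueuePoly.

Variable R : comNzRingType.
Implicit Types a : R.

Definition queue_sum a (n w u : nat) : R :=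
  sum_counts n u (fun cs => if waiting w cs == 0%N then a ^+ delay w cs else 0).

Lemma queue_sum0 a w u :
  queue_sum a 0 w u = ((w == 0%N) && (u == 0%N))%:R.
Proof. by rewrite /queue_sum /=; case: eqP; case: eqP. Qed.

(** Condition on the set of [c] cars preferring the first spot; the exploration of graphs will
    satisfy the same recursion. *)
Lemma queue_sumS a n w u : queue_sum a n.+1 w u =
  \sum_(c < u.+1) (a ^+ (w + c).-1 * queue_sum a n (w + c).-1 (u - c)%N) *+ 'C(u, c).
Proof.
rewrite /queue_sum /=; apply: eq_bigr => c _; congr (_ *+ _); rewrite -sum_countsZ.
by apply: eq_sum_counts => cs /=; case: eqP => _; rewrite ?mulr0 ?exprD.
Qed.

Lemma queue_sum_eq0 a n w u : (n < w + u)%N -> queue_sum a n w u = 0.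
Proof.
elim: n w u => [|n IH] w u lt_n.
  by rewrite queue_sum0; case: w lt_n => //; case: u.
rewrite queue_sumS big1 // => -[c lt_c] _ /=.
by rewrite IH ?mulr0 ?mul0rn //; lia.
Qed.

Lemma sum_PF a n m :
  \sum_(p in PF m n) a ^+ disp p = queue_sum a n 0 m.
Proof.
rewrite /queue_sum -sum_tuple_counts big_mkcond; apply: eq_bigr => p _.
have occE (y : 'I_n) : (y \in set0) = nth true (busy 0 (nseq n 0%N)) y.
  by rewrite busy_nseq0 nth_nseq ltn_ord inE.
have := parkE p (size_nseq n 0%N) occE (waiting_nseq0 n).
rewrite inE /disp /outcome delay_nseq0; case: park => [o|] /=.
  by case=> -> ->.
by move/negPf->.
Qed.

End QueuePoly.

(** * Graph exploration *)

Section Exploration.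

Variable V : finType.
Implicit Types (x y z : V) (W R A N : {set V}) (E : {set {set V}}).

Definition edges A : {set {set V}} := [set e : {set V} | (#|e| == 2) && (e \subset A)].

Definition star x N : {set {set V}} := [set [set x; y] | y in N].

(* State of an exploration: [A] is the set of unprocessed vertices, [W] the queue
   and [R] the set of unused roots. The vertices of [W] belong to one component
   of the explored part, hence may be joined to each other, but not to [R]. *)
Definition explorable W R A E :=
  [&& E \subset edges A,
      [forall v in A, [exists r in W :|: R, connect (adj E) v r]]
    & [forall r in R, forall r' in W :|: R, connect (adj E) r r' ==> (r == r')]].

Lemma explorableP W R A E :
  reflect [/\ E \subset edges A,
              forall v, v \in A -> exists2 r, r \in W :|: R & connect (adj E) v r
            & forall r r', r \in R -> r' \in W :|: R -> connect (adj E) r r' -> r = r']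
          (explorable W R A E).
Proof.
apply: (iffP and3P) => -[EA reach sep]; split=> //.
- by move=> v vA; have /exists_inP := forall_inP reach v vA.
- move=> r r' rR r'WR crr'.
  by have /forall_inP/(_ r' r'WR)/implyP/(_ crr')/eqP := forall_inP sep r rR.
- by apply/forall_inP=> v vA; apply/exists_inP; apply: reach.
- apply/forall_inP=> r rR; apply/forall_inP=> r' r'WR.
  by apply/implyP=> crr'; apply/eqP; apply: sep.
Qed.

Lemma adj_sym E : symmetric (adj E).
Proof. by move=> x y; rewrite /adj /= setUC. Qed.

Lemma connect_adjC E x y : connect (adj E) x y = connect (adj E) y x.
Proof. exact: (sym_connect_sym (adj_sym E)). Qed.

Lemma set2_inj x y z : [set x; y] = [set x; z] -> y = z.
Proof.
move=> eq_xyz.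
have : y \in [set x; z] by rewrite -eq_xyz set22.
have : z \in [set x; y] by rewrite eq_xyz set22.
by rewrite !inE => /orP[/eqP->|/eqP->] // /orP[/eqP->|/eqP->].
Qed.

Lemma edgeP x A (e : {set V}) : e \in edges A -> x \in e ->
  exists2 y, y \in A :\ x & e = [set x; y].
Proof.
rewrite inE => /andP[/cards2P[a [b [neq_ab ->]]]]; rewrite subUset !sub1set.
case/andP=> aA bA /set2P[->|->]; [exists b | exists a] => //.
- by rewrite !inE bA eq_sym neq_ab.
- by rewrite !inE aA neq_ab.
- by rewrite setUC.
Qed.

Lemma edgesD1P x A E : E \subset edges (A :\ x) ->
  E \subset edges A /\ forall e, e \in E -> x \notin e.
Proof.
move/subsetP=> EA; split.
  apply/subsetP=> e /EA; rewrite !inE => /andP[-> /subset_trans -> //].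
  exact: subD1set.
by move=> e /EA; rewrite inE subsetD1 => /and3P[].
Qed.

(** * Splitting a graph at one vertex *)

Section Star.

Variables (x : V) (A N : {set V}) (E : {set {set V}}).
Hypotheses (xA : x \in A) (NA : N \subset A :\ x) (EA : E \subset edges (A :\ x)).

Let xE e : e \in E -> x \notin e.
Proof. by have [_] := edgesD1P EA; apply. Qed.

Lemma star_subset : star x N :|: E \subset edges A.
Proof.
rewrite subUset; have [-> _] := edgesD1P EA; rewrite andbT.
apply/subsetP=> e /imsetP[y yN ->].
have := subsetP NA y yN; rewrite !inE => /andP[neq_yx yA].
by rewrite cards2 (eq_sym x) neq_yx subUset !sub1set xA yA.
Qed.

Lemma mem_star y : ([set x; y] \in star x N :|: E) = (y \in N).
Proof.
rewrite inE; apply/orP/idP => [[/imsetP[z zN /set2_inj->] //|/xE]|yN].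
  by rewrite set21.
by left; apply: imset_f.
Qed.

Lemma starN (e : {set V}) : x \notin e -> (e \in star x N :|: E) = (e \in E).
Proof.
move=> xNe; rewrite inE orb_idl // => /imsetP[y _ eE].
by rewrite eE set21 in xNe.
Qed.

Lemma card_star : #|star x N :|: E| = #|N| + #|E|.
Proof.
rewrite cardsU disjoint_setI0; last first.
  apply/pred0P=> e /=; apply/negP=> /andP[/imsetP[y _ ->] /xE].
  by rewrite set21.
by rewrite cards0 subn0 card_imset // => y z; apply: set2_inj.
Qed.

Lemma star_nbr : [set y | [set x; y] \in star x N :|: E] = N.
Proof. by apply/setP=> y; rewrite inE mem_star. Qed.

Lemma star_rest : [set e in star x N :|: E | x \notin e] = E.
Proof.
apply/setP=> e; rewrite inE andbC; case: (boolP (x \in e)) => /= [xe|/starN //].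
by apply/esym/negP=> /xE; rewrite xe.
Qed.

Lemma adj_star y z : y != x -> z != x ->
  adj (star x N :|: E) y z = adj E y z.
Proof. by move=> neq_y neq_z; apply: starN; rewrite !inE negb_or !(eq_sym x) neq_y. Qed.

Lemma connect_star_sub y z : connect (adj E) y z -> connect (adj (star x N :|: E)) y z.
Proof.
by apply: connect_sub => a b ab; apply: connect1; rewrite /adj /= inE [X in _ || X]ab orbT.
Qed.

(* Follow a path up to its first visit to [x]. *)
Lemma connect_star y z : connect (adj (star x N :|: E)) y z -> y != x ->
  (z != x) && connect (adj E) y z \/ exists2 w, w \in N & connect (adj E) y w.
Proof.
case/connectP=> p; elim: p y => [|a p IH] y /= => [_ -> -> | /andP[ya pth] zE neq_y].
  by left; rewrite connect0.
have [eq_ax|neq_ax] := eqVneq a x.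
  right; exists y; last exact: connect0.
  by rewrite -mem_star setUC -[X in [set _; X]]eq_ax.
have {}ya : connect (adj E) y a by rewrite connect1 // -adj_star.
case: (IH a pth zE neq_ax) => [/andP[neq_z az]|[w wN aw]].
  by left; rewrite neq_z; apply: connect_trans ya az.
by right; exists w => //; apply: connect_trans aw.
Qed.

Lemma explorable_star W R : x \in W -> W \subset A -> R \subset A -> [disjoint W & R] ->
  explorable W R A (star x N :|: E)
  = [disjoint N & R] && explorable (W :\ x :|: N) R (A :\ x) E.
Proof.
move=> xW WA RA WR; have xR : x \notin R by rewrite (disjointFr WR).
have Nx y : y \in N -> connect (adj (star x N :|: E)) y x.
  by move=> yN; rewrite connect1 // /adj /= setUC mem_star.
have neqRx y : y \in R -> y != x by apply: contraTneq => ->.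
apply/explorableP/andP => [[_ reach sep]|[NR /explorableP[_ reach sep]]].
  have NR : [disjoint N & R].
    apply/pred0P=> y /=; apply/negP=> /andP[yN yR].
    have := sep y x yR _ (Nx y yN); rewrite inE xW => /(_ isT) eq_yx.
    by rewrite eq_yx (negPf xR) in yR.
  split=> //; apply/explorableP; split=> // [v|r r' rR r'WR /connect_star_sub crr'].
    rewrite !inE => /andP[neq_v /reach[r rWR /connect_star/(_ neq_v)]].
    case=> [/andP[neq_r cvr]|[w wN cvw]].
      by exists r => //; move: rWR; rewrite !inE neq_r => /orP[->|->]; rewrite ?orbT.
    by exists w => //; rewrite !inE wN orbT.
  move: r'WR; rewrite !inE -orbA => /or3P[/andP[_ r'W]|r'N|r'R].
  - by apply: sep => //; rewrite inE r'W.
  - have := sep r x rR _ (connect_trans crr' (Nx r' r'N)).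
    by rewrite inE xW => /(_ isT) eq_rx; rewrite eq_rx (negPf xR) in rR.
  - by apply: sep => //; rewrite inE r'R orbT.
split; first exact: star_subset.
  move=> v vA; have [->|neq_v] := eqVneq v x.
    by exists x; rewrite ?connect0 // inE xW.
  have [|r] := reach v; first by rewrite !inE neq_v.
  rewrite !inE -orbA => /or3P[/andP[_ rW]|rN|rR] /connect_star_sub cvr.
  - by exists r => //; rewrite inE rW.
  - by exists x; [rewrite inE xW | apply: connect_trans (Nx r rN)].
  - by exists r => //; rewrite inE rR orbT.
move=> r r' rR r'WR /connect_star/(_ (neqRx r rR)).
case=> [/andP[neq_r' crr']|[w wN crw]].
  apply: sep => //; move: r'WR; rewrite !inE neq_r' => /orP[->|->] //.
  by rewrite orbT.
have eq_rw : r = w by apply: sep => //; rewrite !inE wN orbT.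
by rewrite eq_rw (disjointFr NR wN) in rR.
Qed.

End Star.

Lemma explorable_promote R A E r : r \in R ->
  explorable [set r] (R :\ r) A E = explorable set0 R A E.
Proof.
move=> rR; have setE : [set r] :|: R :\ r = set0 :|: R by rewrite setD1K // set0U.
apply/explorableP/explorableP; rewrite setE => -[EA reach sep]; split=> //.
  move=> a b aR; rewrite set0U => bR cab.
  (* Taking [r] out of the roots drops only the separation of pairs that start at [r]; reversing the
     path recovers them. *)
  have [eq_ar|neq_ar] := eqVneq a r; last first.
    by apply: sep => //; rewrite ?inE ?neq_ar // bR.
  have [eq_br|neq_br] := eqVneq b r; first by rewrite eq_ar.
  by apply/esym/sep; rewrite ?inE ?neq_br ?aR ?orbT // connect_adjC.
by move=> a b /setD1P[_ aR] bR; apply: sep.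
Qed.

Lemma explorable_set0 A E :
  explorable set0 set0 A E = (A == set0) && (E == set0).
Proof.
apply/explorableP/andP => [[EA reach _]|[/eqP-> /eqP->]]; last first.
  by split=> [|v|r]; rewrite ?sub0set ?inE.
have A0 : A = set0.
  by apply/setP=> v; rewrite inE; apply/negP=> /reach[r]; rewrite !inE.
split; first by rewrite A0.
rewrite -subset0; apply: subset_trans EA _; apply/subsetP=> e.
by rewrite A0 inE subset0 andbC => /andP[/eqP->]; rewrite cards0.
Qed.

Local Open Scope ring_scope.

(** An edge set amounts to the neighbourhood of [x] together with the edges avoiding [x]; [h']
    extracts this pair. *)
Lemma sum_edges_split (T : nmodType) (F : {set {set V}} -> T) A x : x \in A ->
  \sum_(E : {set {set V}} | E \subset edges A) F E
  = \sum_(N : {set V} | N \subset A :\ x)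
      \sum_(E : {set {set V}} | E \subset edges (A :\ x)) F (star x N :|: E).
Proof.
move=> xA; rewrite pair_big /=.
pose h' E := ([set y | [set x; y] \in E], [set e in E | x \notin e]).
have h'P E : E \subset edges A ->
    [/\ (h' E).1 \subset A :\ x, (h' E).2 \subset edges (A :\ x)
      & star x (h' E).1 :|: (h' E).2 = E].
  move/subsetP=> EA; split.
  - apply/subsetP=> y; rewrite inE => /EA xyA.
    by have [z zA /set2_inj->] := edgeP xyA (set21 x y).
  - apply/subsetP=> e; rewrite inE => /andP[/EA]; rewrite !inE => /andP[-> eA] xe.
    by rewrite subsetD1 eA.
  apply/setP=> e; rewrite !inE; apply/orP/idP => [[/imsetP[y + ->]|/andP[]//]|eE].
    by rewrite inE.
  have [xe|xe] := boolP (x \in e); [left | by right; rewrite eE].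
  have [y _ eE'] := edgeP (EA e eE) xe.
  by apply/imsetP; exists y; rewrite // inE -eE'.
rewrite (reindex_onto (fun NE => star x NE.1 :|: NE.2) h') /=; last by move=> E /h'P[].
apply: eq_bigl => -[N E] /=; apply/andP/andP => [[/h'P[] + + _ /eqP eqh]|[NA EA]].
  by rewrite eqh.
split; first exact: star_subset.
by rewrite /h' (star_nbr N EA) (star_rest N EA).
Qed.

End Exploration.

(** * Generating polynomials *)

Local Open Scope ring_scope.

Section SubsetSums.

Variables (T : finType) (M : nmodType).

Lemma sum_subsets_card (B : {set T}) (f : nat -> M) :
  \sum_(C : {set T} | C \subset B) f #|C| = \sum_(c < #|B|.+1) f c *+ 'C(#|B|, c).
Proof.
have ltB (C : {set T}) : C \subset B -> (#|C| < #|B|.+1)%N by move/subset_leq_card.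
rewrite (partition_big (fun C : {set T} => inord #|C| : 'I_#|B|.+1) predT) //=.
apply: eq_bigr => c _; rewrite -cards_draws -[X in _ *+ X]sum1_card -sumrMnr.
rewrite big_mkcond [RHS]big_mkcond; apply: eq_bigr => C _; rewrite inE.
have [/ltB lt_C|//] := boolP (C \subset B).
by rewrite -val_eqE /= inordK //; case: eqP => [->|//]; rewrite mulr1n.
Qed.

Lemma sum_subsetsU (B1 B2 : {set T}) (F : {set T} -> M) : [disjoint B1 & B2] ->
  \sum_(C : {set T} | C \subset B1 :|: B2) F C
  = \sum_(C1 : {set T} | C1 \subset B1) \sum_(C2 : {set T} | C2 \subset B2) F (C1 :|: C2).
Proof.
move=> B12; rewrite pair_big /=.
rewrite (reindex_onto (fun CD => CD.1 :|: CD.2) (fun C => (C :&: B1, C :&: B2))) /=.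
  apply: eq_bigl => -[C D] /=; apply/andP/andP => [[_ /eqP[<- <-]]|[CB DB]].
    by rewrite !subsetIr.
  rewrite setUSS //; split=> //; apply/eqP; congr (_, _).
    rewrite setIUl (setIidPl CB) [D :&: _]disjoint_setI0 ?setU0 //.
    by rewrite disjoint_sym (disjointWr DB).
  by rewrite setIUl (setIidPl DB) [C :&: _]disjoint_setI0 ?set0U // (disjointWl CB).
by move=> C /setIidPl CB; rewrite -setIUr.
Qed.

End SubsetSums.

(** This evaluates the sum over the optional edges from the processed vertex to the rest of the
    queue. *)
Lemma sum_subsets_expr (T : finType) (R : comNzRingType) (t : R) (B : {set T}) :
  \sum_(C : {set T} | C \subset B) t ^+ #|C| = (1 + t) ^+ #|B|.
Proof.
rewrite (sum_subsets_card B (fun c => t ^+ c)) exprDn.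
by apply: eq_bigr => c _; rewrite expr1n mul1r.
Qed.

(** * Generating polynomial of explorable graphs by number of edges *)

Section GraphSum.

Variables (V : finType) (K : comNzRingType) (t : K).
Implicit Types (W R A N : {set V}).

Definition graph_sum W R A : K :=
  \sum_(E : {set {set V}} | explorable W R A E) t ^+ #|E|.

Lemma graph_sum_star W R A x :
    x \in W -> W \subset A -> R \subset A -> [disjoint W & R] ->
  graph_sum W R A
  = \sum_(N : {set V} | N \subset A :\ x :\: R)
      t ^+ #|N| * graph_sum (W :\ x :|: N) R (A :\ x).
Proof.
move=> xW WA RA WR; have xA := subsetP WA x xW.
have -> : graph_sum W R A = \sum_(E : {set {set V}} | E \subset edges A)
    if explorable W R A E then t ^+ #|E| else 0.
  rewrite -big_mkcondr; apply: eq_bigl => E.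
  by rewrite andb_idl // => /and3P[].
rewrite (sum_edges_split _ xA) big_mkcond [RHS]big_mkcond; apply: eq_bigr => N _.
rewrite [N \subset A :\ x :\: R]subsetD; case: ifP => //= NA.
have [NR|NR] /= := boolP [disjoint N & R]; last first.
  by apply: big1 => E EA; rewrite explorable_star // (negPf NR).
rewrite mulr_sumr -big_mkcondr; apply: eq_big => [E|E /andP[EA _]].
  case: (boolP (E \subset _)) => [EA|/negPf EA]; first by rewrite explorable_star // NR.
  by rewrite /explorable EA.
by rewrite (card_star N EA) exprD.
Qed.

Lemma graph_sum_promote R A r : r \in R ->
  graph_sum [set r] (R :\ r) A = graph_sum set0 R A.
Proof. by move=> rR; apply: eq_bigl => E; apply: explorable_promote. Qed.

Lemma graph_sum_set0 A : graph_sum set0 set0 A = (A == set0)%:R.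
Proof.
rewrite /graph_sum; case: eqP => [->|A0]; last first.
  by apply: big_pred0 => E; rewrite explorable_set0; case: eqP A0.
rewrite (big_pred1 set0) ?cards0 // => E.
by rewrite explorable_set0 eqxx.
Qed.

(* [w] is the size of the queue without the vertex being processed, which is the
   number of cars still waiting once the current spot is taken; [n] spots and as
   many vertices remain after these, and [u] vertices are undiscovered. *)
Definition closed_form (n w u : nat) : K :=
  t ^+ u * ((1 + t) ^+ w * queue_sum (1 + t) n w u).

(** An empty queue is handled by promoting a root. The closed form is unaffected, since queues of
    sizes 0 and 1 have the same truncated predecessor. *)
Lemma graph_sumE_set0 n :
    (forall W R A x, x \in W -> #|A| = n.+1 ->
       W \subset A -> R \subset A -> [disjoint W & R] ->
     graph_sum W R A = closed_form n #|W|.-1 #|A :\: (W :|: R)|) ->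
  forall W R A, #|A| = n.+1 -> W \subset A -> R \subset A -> [disjoint W & R] ->
  graph_sum W R A = closed_form n #|W|.-1 #|A :\: (W :|: R)|.
Proof.
move=> IH W R A cardA; have [->|[x xW]] := set_0Vmem W; last exact: IH xW cardA.
move=> _ RA _; have [->|[r rR]] := set_0Vmem R.
  (* Without queue and roots the remaining vertices are unreachable; correspondingly, [n.+1] cars
     compete for [n] spots. Both sides vanish. *)
  rewrite /closed_form graph_sum_set0 -cards_eq0 cardA cards0 setU0 setD0.
  by rewrite queue_sum_eq0 ?mulr0 // cardA.
rewrite -(graph_sum_promote _ rR) (IH _ _ _ r) ?set11 //.
- by rewrite setD1K // set0U cards1 cards0.
- by rewrite sub1set (subsetP RA).
- by apply: subset_trans RA; apply: subD1set.
- by rewrite disjoints1 !inE eqxx.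
Qed.

(** Induction on the number of vertices, deleting a queue vertex [x]. Its neighbours are a set [C]
    of undiscovered vertices and a set [D] of queue vertices; only [C] changes the later
    exploration. *)
Lemma graph_sumE n W R A :
    #|A| = n.+1 -> W \subset A -> R \subset A -> [disjoint W & R] ->
  graph_sum W R A = closed_form n #|W|.-1 #|A :\: (W :|: R)|.
Proof.
elim: n W R A => [|n IHn]; apply: graph_sumE_set0 => W R A x xW cardA WA RA WR.
  have A1 : A = [set x].
    have /eqP/cards1P[y A1] := cardA.
    by have := subsetP WA x xW; rewrite A1 inE => /eqP->.
  have W1 : W = [set x].
    by apply/eqP; rewrite eqEsubset sub1set xW -A1 WA.
  have R0 : R = set0.
    apply/setP=> y; rewrite inE; apply/negP=> yR.
    have := subsetP RA y yR; rewrite A1 inE => /eqP eq_yx.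
    by rewrite eq_yx (disjointFr WR xW) in yR.
  rewrite (graph_sum_star xW) // A1 W1 R0 setU0 setDv setD0 cards1 cards0.
  rewrite (big_pred1 set0) => [|N]; last by rewrite subset0.
  rewrite setU0 graph_sum_set0 /closed_form cards0 queue_sum0 eqxx.
  by rewrite !expr0 !mul1r.
rewrite (graph_sum_star xW) //.
set U := A :\: (W :|: R); set w := #|W|.-1.
have xA := subsetP WA x xW.
have xR : x \notin R by rewrite (disjointFr WR).
have UW : [disjoint U & W :\ x].
  apply/pred0P=> y; apply/negP=> /andP[/=].
  by rewrite !inE negb_or; case/andP=> /andP[/negPf->]; rewrite andbF.
have -> : A :\ x :\: R = U :|: W :\ x.
  apply/setP=> y; rewrite !inE.
  have [->|] := eqVneq y x; first by rewrite xW !andbF.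
  have [yW|yW] := boolP (y \in W) => /=.
    by rewrite (subsetP WA) // (disjointFr WR yW).
  by rewrite orbF.
have cardWx : #|W :\ x| = w by rewrite /w (cardsD1 x W) xW.
rewrite sum_subsetsU //.
(* The contribution of all [C] of size [c] is [f c] each: [t ^+ c] for the edges to [C],
   [(1 + t) ^+ w] for the choices of [D], and the closed form for the new queue of size [w + c]. *)
pose f c := t ^+ c * (1 + t) ^+ w * (t ^+ (#|U| - c)
  * ((1 + t) ^+ (w + c).-1 * queue_sum (1 + t) n (w + c).-1 (#|U| - c))).
transitivity (\sum_(C : {set V} | C \subset U) f #|C|).
  apply: eq_bigr => C CU.
  rewrite /f -cardWx -sum_subsets_expr mulr_sumr mulr_suml.
  apply: eq_bigr => D DW.
  have CW : [disjoint C & W :\ x] := disjointWl CU UW.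
  rewrite cardsU disjoint_setI0 ?cards0 ?subn0 ?(disjointWr DW) // exprD.
  have -> : W :\ x :|: (C :|: D) = W :\ x :|: C.
    by rewrite setUC -setUA (setUidPr DW) setUC.
  have CA : C \subset A by apply: subset_trans CU (subsetDl _ _).
  have xC : x \notin C.
    by apply: contraL xW => /(subsetP CU); rewrite !inE negb_or; case: (x \in W).
  have CR : [disjoint C & R].
    apply: disjointWl CU _; apply/pred0P=> y /=; apply/negP=> /andP[].
    by rewrite !inE => /andP[+ _] yR; rewrite yR orbT.
  rewrite IHn //; last 4 first.
  - by move: cardA; rewrite (cardsD1 x) xA => -[].
  - by rewrite subUset setSD //= subsetD1 CA.
  - by rewrite subsetD1 RA.
  - rewrite disjoints_subset subUset -!disjoints_subset CR andbT.
    exact: disjointWl (subD1set _ _) WR.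
  have -> : #|W :\ x :|: C| = (w + #|C|)%N.
    by rewrite cardsU disjoint_setI0 ?cards0 ?subn0 ?cardWx // disjoint_sym.
  have -> : A :\ x :\: (W :\ x :|: C :|: R) = U :\: C.
    apply/setP=> y; rewrite !inE; have [->|] := eqVneq y x.
      by rewrite xW !andbF.
    by case: (y \in W); case: (y \in C); case: (y \in R).
  by rewrite cardsD (setIidPr CU) cardWx.
rewrite (sum_subsets_card U f) /closed_form queue_sumS !mulr_sumr; apply: eq_bigr => -[c lt_c] _ /=.
rewrite -!mulrnAr mulrnAr !mulrnAr; congr (_ *+ _).
have -> : t ^+ #|U| = t ^+ c * t ^+ (#|U| - c) by rewrite -exprD subnKC.
rewrite /f; ring.
Qed.

End GraphSum.

(** * Rooted graphs and comparison of coefficients *)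

Lemma rooted_graphsE (V : finType) (S : {set V}) e :
  rooted_graphs S e #|S|
  = [set E | explorable set0 S [set: V] E & #|E| == e].
Proof.
apply/setP=> E; rewrite !inE.
pose comp x := [set y | connect (adj E) x y].
have compE x y : connect (adj E) x y -> comp x = comp y.
  move=> cxy; apply/setP=> z; rewrite !inE.
  exact: (same_connect (sym_connect_sym (adj_sym E))).
apply/and4P/andP => [[/forall_inP simE eE _ /forall_inP one]|[/explorableP[EA reach sep] eE]].
  have {}one v : exists r, comp v :&: S = [set r].
    by apply/cards1P; apply: one; apply/imsetP; exists v.
  split=> //; apply/explorableP; rewrite set0U; split.
  - by apply/subsetP=> e' /simE e'2; rewrite inE e'2 subsetT.
  - move=> v _; have [r vr] := one v; exists r.
      by have := set11 r; rewrite -vr inE => /andP[].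
    by have := set11 r; rewrite -vr !inE => /andP[].
  - move=> r r' rS r'S crr'; have [a ra] := one r.
    have : r \in comp r :&: S by rewrite !inE connect0.
    have : r' \in comp r :&: S by rewrite !inE crr'.
    by rewrite ra !inE => /eqP-> /eqP->.
rewrite set0U in reach sep; split=> //.
- by apply/forall_inP=> e' /(subsetP EA); rewrite inE => /andP[].
(* Every component is that of a root, and distinct roots have distinct components, so there are
   [#|S|] of them. *)
- have -> : components E = comp @: S.
    apply/setP=> C; apply/imsetP/imsetP => [[v _ ->]|[r _ ->]]; last by exists r.
    by have [//|r rS /compE cvr] := reach v; exists r.
  rewrite card_in_imset // => r r' rS r'S eq_comp; apply: sep => //.
  have : r' \in comp r by rewrite eq_comp inE connect0.
  by rewrite inE.
- apply/forall_inP=> C /imsetP[v _ ->]; have [//|r rS cvr] := reach v.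
  apply/cards1P; exists r; apply/setP=> y; rewrite !inE.
  apply/andP/eqP => [[cvy yS]|->//].
  by apply: sep => //; rewrite connect_adjC; apply: connect_trans cvy; rewrite connect_adjC.
Qed.

Lemma coef_1DX_exp d k : ((1 + 'X : {poly int}) ^+ d)`_k = 'C(d, k)%:R.
Proof.
rewrite exprDn coef_sum.
under eq_bigr => i _ do rewrite expr1n mul1r coefMn coefXn.
have [lt_k|le_dk] := ltnP k d.+1.
  rewrite (bigD1 (Ordinal lt_k)) //= eqxx big1 ?addr0 // => i neq_ik.
  by rewrite eq_sym -(inj_eq val_inj) /= in neq_ik; rewrite (negPf neq_ik) mul0rn.
rewrite bin_small // big1 // => i _.
by rewrite gtn_eqF ?mul0rn // (leq_trans (ltn_ord i)).
Qed.

Lemma sum_binom_disp (V : finType) (S : {set V}) n m k :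
    #|V| = n.+1 -> #|V| = (m + #|S|)%N ->
  \sum_(p in PF m n) 'C(disp p, k)%:R
  = #|[set E | explorable set0 S [set: V] E & #|E| == (m + k)%N]|%:R :> int.
Proof.
rewrite -cardsT => cardV cardVS.
have cardM : #|[set: V] :\: (set0 :|: S)| = m.
  by rewrite set0U setTD cardsCs setCK -cardsT cardVS addnK.
have := graph_sumE ('X : {poly int}) cardV (sub0set _) (subsetT S) _.
rewrite cardM cards0 -setI_eq0 set0I eqxx /closed_form expr0 mul1r -sum_PF => /(_ isT).
move/(congr1 (fun p : {poly int} => p`_(m + k))).
rewrite coefXnM ltnNge leq_addr /= addKn !coef_sum => coefE.
under eq_bigr => p _ do rewrite -coef_1DX_exp.
rewrite -coefE -sum1_card natr_sum.
rewrite big_mkcond [RHS]big_mkcond; apply: eq_bigr => E _.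
rewrite inE coefXn eq_sym; case: (explorable _ _ _ _) => //=.
by case: eqP.
Qed.

Local Close Scope ring_scope.

Theorem theorem2p9 (s m k : nat) (hs : 1 <= s)
    (V : finType) (hV : #|V| = m + s) (S : {set V}) (hS : #|S| = s) :
  \sum_(p in PF m (m + s - 1)) 'C(disp p, k) = #|rooted_graphs S (m + k) s|.
Proof.
rewrite -hS in hs hV *; rewrite rooted_graphsE.
apply/eqP; rewrite -(eqr_nat int) natr_sum (sum_binom_disp _ _ hV) //.
(* Since [S] is nonempty, there is exactly one more vertex than there are spots. *)
by rewrite hV; lia.
Qed.
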